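(* Let $(\Gamma,P)$, with $\Gamma=(N,K,C,T)$ and $P=\{P_1,\dots,P_A\}$, be a generalized highway problem with a coalitional structure and $(N,c,P)$ its associated game with a coalitional structure. The coalitional Tijs value of the game $(N,c,P)$ is given by $$\mathcal{T}_i(N,c,P)=\begin{cases}c^e(i)&\text{if }K^s=\emptyset,\\[2pt] c^e(i)+\bigl(\mathcal{T}_a(N,c,P)-c^e(a)\bigr)\cdot\dfrac{c^s(i)}{\sum_{j\in P_a}c^s(j)}&\text{if }K^s\neq\emptyset,\end{cases}$$ with $c^e(a)=\sum_{j\in P_a}c^e(j)$, for all $i\in P_a\in P$. Here $\mathcal{T}_a(N,c,P)=\sum_{j\in P_a}\mathcal{T}_j(N,c,P)=\tau_a(M,c_P)$ is the Tijs value of union $a$ in the quotient game.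
   Context: A generalized highway problem is a 4-tuple $\Gamma=(N,K,C,T)$ where $N$ is a finite set of agents, $K$ is a finite nonempty ordered set of sections, $C:K\to\mathbb{R}_+$ gives the cost of each section, and $T:N\to 2^K\setminus\{\emptyset\}$ gives the set of sections used by each agent, with $\bigcup_{i\in N}T(i)=K$. For $S\subseteq N$ put $T(S)=\bigcup_{i\in S}T(i)$, and for $K'\subseteq K$ put $C(K')=\sum_{t\in K'}C(t)$. The associated cost game is $(N,c)$ with $c(S)=C(T(S))$; it is concave. If $P=\{P_1,\dots,P_A\}$ is a partition of $N$ (into a priori unions), $(\Gamma,P)$ is a generalized highway problem with a coalitional structure and $(N,c,P)$ its associated game with a coalitional structure. Let $M=\{1,\dots,A\}$; the quotient game is $(M,c_P)$ with $c_P(H)=c(\bigcup_{a\in H}P_a)$, $H\subseteq M$. Let $N_t=\{j\in N\mid t\in T(j)\}$, $K^e=\{t\in K\mid|N_t|=1\}$ (exclusive use sections), $K^s=\{t\in K\mid|N_t|>1\}$ (shared use sections), $T^e(i)=T(i)\cap K^e$, $T^s(i)=T(i)\setminus T^e(i)$, $c^e(i)=C(T^e(i))$, $c^s(i)=C(T^s(i))$. Tijs value of a concave cost game $(N,c)$: $\tau_i(N,c)=m_i+\alpha(M_i-m_i)$, where $M_i=c(N)-c(N\setminus\{i\})$, $m_i=\min_{S\subseteq N,\,i\in S}\{c(S)-\sum_{j\in S\setminus\{i\}}M_j\}$, and $\alpha\in[0,1]$ is such that $\sum_{i\in N}\tau_i(N,c)=c(N)$. Coalitional Tijs value of $(N,c,P)$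 with $(N,c)$ concave: for $i\in P_a$, $\mathcal{T}_i(N,c,P)=m_i+\alpha_a(M_i-m_i)$, where $M_i=c(N)-c(N\setminus\{i\})$, $m_i=\min_{S\in P(a),\,i\in S}\{c(S)-\sum_{j\in S\setminus\{i\}}M_j\}$, $P(a)=\{\bigcup_{l\in L}P_l\cup T'\mid L\subseteq M\setminus\{a\},\,T'\subseteq P_a\}$, and $\alpha_a\in[0,1]$ is such that $\sum_{i\in P_a}\mathcal{T}_i(N,c,P)=\tau_a(M,c_P)$. *)

(* Defs.v *)
From HB Require Import structures.
From mathcomp Require Import all_boot all_order all_algebra.
From mathcomp Require Import reals.
From mathcomp Require classical_sets.

Set Implicit Arguments.
Unset Strict Implicit.
Unset Printing Implicit Defensive.

Import Order.TTheory GRing.Theory Num.Theory.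
Local Open Scope ring_scope.

Section Games.
Variables (R : realType) (N : finType).

Definition game := {set N} -> R.

Implicit Type c : game.

(* M_i *)
Definition marginal c (i : N) : R := c [set: N] - c ([set: N] :\ i).

Definition residual c (i : N) (S : {set N}) : R :=
  c S - \sum_(j in S :\ i) marginal c j.

(* m_i; the starting value of the minimum is the term of the admissible
   coalition {i}, so it does not change the minimum. *)
Definition min_right c (i : N) : R :=
  \big[Num.min/residual c i [set i]]_(S : {set N} | i \in S) residual c i S.

(* The number alpha exists for every concave game, so the default 0 is not used
   there; it is unique unless M_i = m_i for all i, in which case the Tijs value
   does not depend on it. The same holds for coal_tijs_alpha below. *)
Definition tijs_alpha c : R :=
  classical_sets.xget 0 (fun alpha : R => 0 <= alpha <= 1 /\
    \sum_(i : N) (min_right c i + alpha * (marginal c i - min_right c i))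
      = c [set: N]).

Definition tijs c (i : N) : R :=
  min_right c i + tijs_alpha c * (marginal c i - min_right c i).

End Games.

Section CoalitionalGames.
Variables (R : realType) (N : finType) (A : nat).
Implicit Types (c : game R N) (P : 'I_A -> {set N}).

Definition is_coalition_structure P : Prop :=
  injective P /\ partition [set P a | a : 'I_A] [set: N].

Definition quotient_game c P : game R 'I_A :=
  fun H => c (\bigcup_(a in H) P a).

(* P(a) *)
Definition compatible P (a : 'I_A) : {set {set N}} :=
  [set (\bigcup_(l in L) P l) :|: T'
    | L : {set 'I_A} in powerset (~: [set a]),
      T' : {set N} in powerset (P a)].

(* In the next three definitions a is the index of the union of i, that is,
   i \in P a; then {i} is in P(a). *)
Definition coal_min_right c P (a : 'I_A) (i : N) : R :=
  \big[Num.min/residual c i [set i]]_(S in compatible P a | i \in S)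
     residual c i S.

Definition coal_tijs_alpha c P (a : 'I_A) : R :=
  classical_sets.xget 0 (fun alpha : R => 0 <= alpha <= 1 /\
    \sum_(i in P a) (coal_min_right c P a i
                     + alpha * (marginal c i - coal_min_right c P a i))
      = tijs (quotient_game c P) a).

Definition coal_tijs c P (a : 'I_A) (i : N) : R :=
  coal_min_right c P a i
  + coal_tijs_alpha c P a * (marginal c i - coal_min_right c P a i).

Definition coal_tijs_union c P (a : 'I_A) : R :=
  \sum_(j in P a) coal_tijs c P a j.

End CoalitionalGames.

Record highway (R : realType) (N : finType) (d : Order.disp_t)
    (K : finOrderType d) := Highway {
  cost : K -> R;
  used : N -> {set K};
  sections_nonempty : (0 < #|K|)%N;
  cost_ge0 : forall t, 0 <= cost t;
  used_neq0 : forall i, used i != set0;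
  used_cover : \bigcup_(i : N) used i = [set: K] }.

Section HighwayGame.
Variables (R : realType) (N : finType) (d : Order.disp_t) (K : finOrderType d).
Variable G : highway R N K.

Definition used_by (S : {set N}) : {set K} := \bigcup_(i in S) used G i.

Definition total_cost (K' : {set K}) : R := \sum_(t in K') cost G t.

Definition highway_game : game R N := fun S => total_cost (used_by S).

Definition users (t : K) : {set N} := [set j | t \in used G j].

Definition exclusive_sections : {set K} := [set t | #|users t| == 1%N].

Definition shared_sections : {set K} := [set t | (1 < #|users t|)%N].

Definition used_excl (i : N) : {set K} := used G i :&: exclusive_sections.

Definition used_shared (i : N) : {set K} := used G i :\: used_excl i.

Definition cost_excl (i : N) : R := total_cost (used_excl i).

Definition cost_shared (i : N) : R := total_cost (used_shared i).

End HighwayGame.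

(* Main.v *)
(** A player's marginal cost is c^e(i), since only i uses those sections.
    Dropping the exclusive sections of the other members of a coalition S
    containing i leaves at least the cost of T(i), so m_i = c({i}) =
    c^e(i) + c^s(i), attained at S = {i}.  Hence the coalitional Tijs value is
    c^e(i) + (1 - alpha_a) c^s(i), and summing over P_a identifies 1 - alpha_a.

    That alpha_a exists in [0, 1] means that tau_a(M, c_P) lies between
    sum_(j in P_a) c^e(j) and sum_(j in P_a) c({j}).  The quotient game is itself
    the game of a highway whose agents are the unions, so tau_a lies between the
    cost of the sections exclusive to P_a and the cost of T(P_a); these are
    respectively at least and at most the required bounds. *)
Require Import Defs.
From HB Require Import structures.
From mathcomp Require Import all_boot all_order all_algebra.
From mathcomp Require Import reals.
From mathcomp Require boolp classical_sets.
From mathcomp Require Import ring lra.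

Set Implicit Arguments.
Unset Strict Implicit.
Unset Printing Implicit Defensive.

Import Order.TTheory GRing.Theory Num.Theory.
Local Open Scope ring_scope.

Section HighwayGameTheory.
Variables (R : realType) (N : finType) (d : Order.disp_t) (K : finOrderType d).
Variable G : highway R N K.
Let c := highway_game G.

Lemma total_cost_ge0 (X : {set K}) : 0 <= total_cost G X.
Proof. by apply: sumr_ge0 => t _; apply: cost_ge0. Qed.

Lemma total_cost_le (X Y : {set K}) :
  X \subset Y -> total_cost G X <= total_cost G Y.
Proof.
move=> sXY; rewrite /total_cost [leRHS](big_setID X) /= (setIidPr sXY) lerDl.
exact: total_cost_ge0.
Qed.

Lemma total_costU (X Y : {set K}) :
  [disjoint X & Y] ->
  total_cost G (X :|: Y) = total_cost G X + total_cost G Y.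
Proof.
by move=> dXY; rewrite /total_cost -bigU //; apply: eq_bigl => t; rewrite inE.
Qed.

Lemma total_costD (X Y : {set K}) :
  Y \subset X -> total_cost G (X :\: Y) = total_cost G X - total_cost G Y.
Proof.
by move=> sYX; rewrite /total_cost [in RHS](big_setID Y) /= (setIidPr sYX) addrC addrK.
Qed.

(** Costs are nonnegative, so counting a common section several times can only increase the total.
    This yields the upper bound on the value of a union. *)
Lemma total_cost_bigcup_le (S : {set N}) (F : N -> {set K}) :
  total_cost G (\bigcup_(i in S) F i) <= \sum_(i in S) total_cost G (F i).
Proof.
elim/big_ind2: _ => [|x X y Y leX leY|i _ //].
  by rewrite /total_cost big_set0.
apply: le_trans (lerD leX leY).
have -> : X :|: Y = X :|: (Y :\: X).
  by apply/setP => t; rewrite !inE; case: (t \in X).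
rewrite total_costU; last first.
  by rewrite -setI_eq0; apply/eqP/setP => t; rewrite !inE; case: (t \in X).
by rewrite lerD2l total_cost_le // subsetDl.
Qed.

Lemma used_byT : used_by G [set: N] = [set: K].
Proof. by rewrite -(used_cover G); apply: eq_bigl => i; rewrite inE. Qed.

Lemma used_excl_user (i j : N) (t : K) :
  t \in used_excl G i -> t \in used G j -> j = i.
Proof.
rewrite !inE => /andP[ti /cards1P[k uk]] tj.
have: i \in users G t by rewrite inE.
have: j \in users G t by rewrite inE.
by rewrite uk !inE => /eqP-> /eqP->.
Qed.

Lemma used_exclE (i : N) :
  used_excl G i = [set: K] :\: used_by G ([set: N] :\ i).
Proof.
apply/setP => t; rewrite in_setD in_setT andbT.
apply/idP/idP => [te|nuo].
  apply/bigcupP => -[j]; rewrite !inE andbT => /eqP ji tj.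
  exact: ji (used_excl_user te tj).
have nu j : j != i -> t \notin used G j.
  by move=> ji; apply: contra nuo => tj; apply/bigcupP; exists j; rewrite // !inE ji.
(* Every section has some user, and a section that nobody else uses must therefore be used by
   [i]. *)
have ti : t \in used G i.
  have: t \in \bigcup_(j : N) used G j by rewrite used_cover inE.
  case/bigcupP=> j _ tj; have [<- //|/nu] := eqVneq j i.
  by rewrite tj.
rewrite !inE ti; apply/cards1P; exists i; apply/setP => j; rewrite !inE.
by have [->//|/nu/negbTE] := eqVneq j i.
Qed.

Lemma marginal_highway (i : N) : marginal c i = cost_excl G i.
Proof.
rewrite /cost_excl used_exclE total_costD ?subsetT // /marginal /c.
by rewrite /highway_game used_byT.
Qed.

Lemma highway_game1 (i : N) : c [set i] = cost_excl G i + cost_shared G i.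
Proof.
rewrite /c /highway_game /used_by big_set1 /cost_shared total_costD ?subsetIl //.
by rewrite addrC subrK.
Qed.

(* The exclusive sections of the players of D are used by nobody outside D,
   and two players of D have no such section in common. *)
Lemma highway_game_ge (S D : {set N}) :
  [disjoint S & D] -> c S + \sum_(j in D) cost_excl G j <= c (S :|: D).
Proof.
move=> dSD.
have -> : \sum_(j in D) cost_excl G j
    = total_cost G (\bigcup_(j in D) used_excl G j).
  (* The membership condition moves into the family, with [set0] outside [D], so that disjointness
     is stated over all of [N]. *)
  rewrite /total_cost !(big_mkcond (mem D)) /= partition_disjoint_bigcup.
    by apply: eq_bigr => j _; case: ifP => // _; rewrite big_set0.
  move=> i j ij; rewrite -setI_eq0.
  case: ifP => _; case: ifP => _; rewrite ?setI0 ?set0I //.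
  apply/eqP/setP => t; rewrite in_setI in_set0; apply/negP.
  case/andP=> ti /setIP[tj _]; move: ij.
  by rewrite (used_excl_user ti tj) eqxx.
rewrite /c /highway_game -total_costU; last first.
  rewrite -setI_eq0; apply/eqP/setP => t; rewrite in_setI in_set0; apply/negP.
  case/andP=> /bigcupP[i iS ti] /bigcupP[j jD tj].
  by move/disjointFr: dSD => /(_ _ iS); rewrite (used_excl_user tj ti) jD.
apply: total_cost_le; rewrite /used_by bigcup_setU setUS //.
by apply/bigcupsP => j jD; rewrite (bigcup_max j) // subsetIl.
Qed.

Lemma residual_highway_ge (i : N) (S : {set N}) :
  i \in S -> c [set i] <= residual c i S.
Proof.
move=> iS; rewrite /residual lerBrDr.
under eq_bigr do rewrite marginal_highway.
have := @highway_game_ge [set i] (S :\ i); rewrite setD1K //; apply.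
by rewrite disjoints1 !inE eqxx.
Qed.

Lemma residual_highway1 (i : N) : residual c i [set i] = c [set i].
Proof. by rewrite /residual setDv big_set0 subr0. Qed.

(** The starting value is already a lower bound of all terms. Keeping [Q] arbitrary covers both the
    Tijs minimum and the coalitional one. *)
Lemma bigmin_residual_highway (Q : pred {set N}) (i : N) :
  (forall S, Q S -> i \in S) ->
  \big[Num.min/residual c i [set i]]_(S | Q S) residual c i S = c [set i].
Proof.
move=> Qi; rewrite residual_highway1.
elim/big_rec: _ => // S x /Qi iS ->.
by apply/min_idPr/residual_highway_ge.
Qed.

Lemma tijs_highway_bounds (i : N) :
  cost_excl G i <= tijs c i <= c [set i].
Proof.
(* The default 0 also lies in [0, 1], so the bounds need no existence proof for [tijs_alpha]. *)
have le01 : 0 <= tijs_alpha c <= 1.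
  rewrite /tijs_alpha; case: classical_sets.xgetP => [x _ [] //|_].
  by rewrite lexx ler01.
rewrite /tijs marginal_highway /min_right bigmin_residual_highway // highway_game1.
have := total_cost_ge0 (used_shared G i); rewrite -/(cost_shared G i).
by move: le01 => /andP[? ?] ?; nra.
Qed.

Lemma coal_min_right_highway (A : nat) (P : 'I_A -> {set N}) (a : 'I_A) (i : N) :
  coal_min_right c P a i = c [set i].
Proof. by rewrite /coal_min_right bigmin_residual_highway // => S /andP[]. Qed.

Lemma coal_tijs_highway (A : nat) (P : 'I_A -> {set N}) (a : 'I_A) (i : N) :
  coal_tijs c P a i
  = cost_excl G i + (1 - coal_tijs_alpha c P a) * cost_shared G i.
Proof.
rewrite /coal_tijs coal_min_right_highway marginal_highway highway_game1; ring.
Qed.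

(** As alpha runs over [0, 1], the sum over the union sweeps the whole interval given by the two
    bounds, so some alpha attains the required value. *)
Lemma coal_tijs_union_highway (A : nat) (P : 'I_A -> {set N}) (a : 'I_A) :
  \sum_(j in P a) cost_excl G j <= tijs (quotient_game c P) a
    <= \sum_(j in P a) c [set j] ->
  coal_tijs_union c P a = tijs (quotient_game c P) a.
Proof.
rewrite (eq_bigr _ (fun j _ => highway_game1 j)).
rewrite big_split /= => /andP[].
set ce := \sum_(j in _) cost_excl G j; set cs := \sum_(j in _) cost_shared G j.
set tau := tijs _ a => lo hi.
suff /(classical_sets.xgetPex 0)[_ sum_tau] : exists alpha : R, 0 <= alpha <= 1 /\
    \sum_(i in P a) (coal_min_right c P a i
      + alpha * (marginal c i - coal_min_right c P a i)) = tau.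
  exact: sum_tau.
have sumE alpha : \sum_(i in P a) (coal_min_right c P a i
      + alpha * (marginal c i - coal_min_right c P a i))
    = ce + (1 - alpha) * cs.
  rewrite /ce /cs mulr_sumr -big_split /=; apply: eq_bigr => i _.
  by rewrite coal_min_right_highway marginal_highway highway_game1; ring.
(* If [cs] vanishes, the bounds force [tau = ce] and any alpha works; otherwise alpha solves
   [ce + (1 - alpha) * cs = tau]. *)
have [cs0|csn0] := eqVneq cs 0.
  exists 0; rewrite sumE lexx ler01; split=> //; rewrite cs0 in hi *; lra.
have cs_gt0 : 0 < cs by rewrite lt0r csn0 sumr_ge0 // => j _; apply: total_cost_ge0.
exists ((ce + cs - tau) / cs); rewrite sumE; split; last by field.
by rewrite divr_ge0 ?ler_pdivrMr ?(ltW cs_gt0) //=; lra.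
Qed.

End HighwayGameTheory.

Section QuotientHighway.
Variables (R : realType) (N : finType) (d : Order.disp_t) (K : finOrderType d).
Variables (G : highway R N K) (A : nat) (P : 'I_A -> {set N}).
Hypothesis hP : is_coalition_structure P.
Let c := highway_game G.

Lemma coalition_disjoint (a b : 'I_A) : a != b -> [disjoint P a & P b].
Proof.
case: hP => injP /and3P[_ /trivIsetP tiP _] ab.
by apply: tiP; rewrite ?imset_f // (inj_eq injP).
Qed.

Lemma coalition_cover : \bigcup_(a in [set: 'I_A]) P a = [set: N].
Proof.
case: hP => _ /and3P[/eqP <- _ _].
by rewrite cover_imset; apply: eq_bigl => a; rewrite !inE.
Qed.

Lemma quotient_used_neq0 (a : 'I_A) : used_by G (P a) != set0.
Proof.
case: hP => _ /and3P[_ _ P0].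
have /set0Pn[i iPa] : P a != set0.
  by apply: contraNneq P0 => <-; rewrite imset_f.
have /set0Pn[t ti] := used_neq0 G i.
by apply/set0Pn; exists t; apply/bigcupP; exists i.
Qed.

Lemma used_by_bigcup (H : {set 'I_A}) :
  used_by G (\bigcup_(a in H) P a) = \bigcup_(a in H) used_by G (P a).
Proof.
apply/setP => t; apply/bigcupP/bigcupP => [[i /bigcupP[a aH iPa] ti]|[a aH]].
  by exists a => //; apply/bigcupP; exists i.
by case/bigcupP=> i iPa ti; exists i => //; apply/bigcupP; exists a.
Qed.

Lemma quotient_used_cover : \bigcup_(a : 'I_A) used_by G (P a) = [set: K].
Proof.
rewrite -(used_byT G) -coalition_cover used_by_bigcup.
by apply: eq_bigl => a; rewrite inE.
Qed.

Definition quotient_highway : highway R 'I_A K :=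
  Highway (sections_nonempty G) (cost_ge0 G) quotient_used_neq0
    quotient_used_cover.

Lemma quotient_highway_game :
  quotient_game c P = highway_game quotient_highway.
Proof.
by apply/boolp.funext => H; rewrite /quotient_game /c /highway_game used_by_bigcup.
Qed.

Lemma tijs_quotient_bounds (a : 'I_A) :
  \sum_(j in P a) cost_excl G j <= tijs (quotient_game c P) a
    <= \sum_(j in P a) c [set j].
Proof.
rewrite quotient_highway_game.
have /andP[lo hi] := tijs_highway_bounds quotient_highway a.
apply/andP; split.
  (* The exclusive cost of [a] in the quotient is its marginal there, the cost saved when all of
     [P a] leaves; [highway_game_ge] with [D = P a] bounds it below. *)
  apply: le_trans lo; rewrite -marginal_highway -quotient_highway_game.
  rewrite /marginal lerBrDl /quotient_game.
  rewrite [in leRHS](big_setD1 a) ?inE //= setUC.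
  apply: highway_game_ge; rewrite disjoint_sym; apply/bigcup_disjoint => b.
  by rewrite !inE andbT eq_sym => /coalition_disjoint.
apply: le_trans hi _; rewrite -quotient_highway_game /quotient_game big_set1.
rewrite /c /highway_game.
under [leRHS]eq_bigr do rewrite /used_by big_set1.
exact: total_cost_bigcup_le.
Qed.

End QuotientHighway.

Theorem proposition3p4 (R : realType) (N : finType) (d : Order.disp_t)
    (K : finOrderType d) (G : highway R N K) (A : nat)
    (P : 'I_A -> {set N}) (hP : is_coalition_structure P) :
  let c := highway_game G in
  forall (a : 'I_A),
    coal_tijs_union c P a = tijs (quotient_game c P) a /\
    forall (i : N), i \in P a ->
      coal_tijs c P a i =
        if shared_sections G == set0 then cost_excl G i
        else cost_excl G i
             + (coal_tijs_union c P a - \sum_(j in P a) cost_excl G j)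
               * (cost_shared G i / \sum_(j in P a) cost_shared G j).
Proof.
move=> c a; have unionE := coal_tijs_union_highway (tijs_quotient_bounds G hP a).
split=> // i iPa; rewrite coal_tijs_highway.
case: eqP => [noshared|_].
  suff -> : cost_shared G i = 0 by rewrite mulr0 addr0.
  rewrite /cost_shared /total_cost big1 // => t; rewrite !inE => /andP[te ti].
  have: t \notin shared_sections G by rewrite noshared inE.
  (* A section that is not shared has one user or none: one is excluded because [t] is not
     exclusive, none because [i] uses [t]. *)
  move: te; rewrite ti inE /= -leqNgt leq_eqVlt ltnS leqn0 cards_eq0.
  by move=> /negbTE-> /eqP/setP/(_ i); rewrite !inE ti.
rewrite /coal_tijs_union.
under eq_bigr do rewrite coal_tijs_highway.
rewrite big_split /= -mulr_sumr addrAC subrr add0r -mulrA; congr (_ + _ * _).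
(* When the union has no shared cost, cost_shared G i = 0, which agrees with
   the quotient 0 / 0 = 0. *)
have [cs0|cs_neq0] := eqVneq (\sum_(j in P a) cost_shared G j) 0.
  rewrite cs0 mul0r; apply: (psumr_eq0P _ cs0) => // j _.
  exact: total_cost_ge0.
by rewrite mulrC divfK.
Qed.
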